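(* Let $\alpha_0\neq0$, $\epsilon_0=+1$, $\mathfrak a\in\mathbb R$, and let $D\subset\mathbb R^2$ be a connected open set of points $(p,q)$ with smooth functions $\mathcal P(p)$, $\mathcal Q(q)$ such that, with $\Omega=1-\mathfrak a\,pq$ and $\mathcal R:=\mathcal Q-\mathcal P$, $$\Omega>0,\quad \mathcal P>0,\quad \mathcal Q>0,\quad \mathcal R>0\quad\text{on }D$$ (a physical Carter region). Then every local solution of the Einstein–Maxwell–dilaton equations on $D$ whose metric is the conformal Carter metric built from $(\Omega,\mathcal P,\mathcal Q)$ satisfies $$C=0,\qquad B_-=0 \quad\text{on }D;$$ hence the scalar field $\phi$ is constant and the Maxwell field is aligned with the two Carter principal null directions.
   Context: Conformal Carter metric, $\Sigma:=p^2+q^2$: $$g=\frac1{\Omega^2}\Big[-\frac{\mathcal Q}{\Sigma}(\mathrm dt-p^2\mathrm d\varphi)^2+\frac{\Sigma}{\mathcal Q}\mathrm dq^2+\frac{\Sigma}{\mathcal P}\mathrm dp^2+\frac{\mathcal P}{\Sigma}(\mathrm dt+q^2\mathrm d\varphi)^2\Big].$$ Einstein–Maxwell–dilaton (EMD) equations, signature $(-,+,+,+)$, with $\kappa:=e^{-\alpha_0\phi}$ (from the action $\int\sqrt{-g}\,[R-2\epsilon_0(\nabla\phi)^2-e^{-2\alpha_0\phi}F^2]$): $$R_{\mu\nu}=2\epsilon_0\phi_{,\mu}\phi_{,\nu}+2\kappa^2\big(F_{\mu\lambda}F_\nu{}^\lambda-\tfrac14g_{\mu\nu}F_{\alpha\beta}F^{\alpha\beta}\big),\quad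 \nabla_\mu(\kappa^2F^{\mu\nu})=0,\quad \Box\phi=-\frac{\alpha_0}{2\epsilon_0}\kappa^2F_{\alpha\beta}F^{\alpha\beta},$$ $F=\mathrm d\mathcal A$, $\mathcal A=A_t\mathrm dt+A_\varphi\mathrm d\varphi$, with $A_t,A_\varphi,\phi$ smooth functions of $(p,q)$ only. Potential 1-forms on the $(p,q)$ plane: $f:=\mathcal R/(\Omega^2\Sigma)$, $\omega:=(\mathcal Qp^2+\mathcal Pq^2)/\mathcal R$, $\rho:=\sqrt{\mathcal P\mathcal Q}/\Omega^2$; Hodge operator $\star\,\mathrm dp=\sqrt{\mathcal P/\mathcal Q}\,\mathrm dq$, $\star\,\mathrm dq=-\sqrt{\mathcal Q/\mathcal P}\,\mathrm dp$; $\psi:=2A_t$ and $\mathrm d\chi:=\kappa^2\star[\tfrac{2f}{\rho}(\omega\,\mathrm dA_t+\mathrm dA_\varphi)]$ (closed by Maxwell's equations). Then $$B=B_p\mathrm dp+B_q\mathrm dq:=-\frac1{2\sqrt f}\Big(\kappa\,\mathrm d\psi-\frac{i}{\kappa}\mathrm d\chi\Big),\qquad C:=\alpha_0\,\mathrm d\phi,\qquad B_-:=B_p-iB_q .$$ The Carter principal null directions are spanned by $e_0\pm e_1$, where $e_0,e_1$ are the frame vectors dual to $\vartheta^0=\Omega^{-1}\sqrt{\mathcal Q/\Sigma}(\mathrm dt-p^2\mathrm d\varphi)$, $\vartheta^1=\Omega^{-1}\sqrt{\Sigma/\mathcal Q}\,\mathrm dq$ in the orthonormal coframe completed by $\vartheta^2=\Omega^{-1}\sqrt{\Sigma/\mathcal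 P}\,\mathrm dp$, $\vartheta^3=\Omega^{-1}\sqrt{\mathcal P/\Sigma}(\mathrm dt+q^2\mathrm d\varphi)$; ''aligned'' means that $F_{\mu\nu}k^\mu m^\nu=0=F_{\mu\nu}\bar m^\mu l^\nu$ for $k=(e_0+e_1)/\sqrt2$, $l=(e_0-e_1)/\sqrt2$, $m=(e_3+ie_2)/\sqrt2$. *)

(* Defs.v *)
From Stdlib Require Export Reals.
From Coquelicot Require Export Coquelicot.

Open Scope R_scope.

Definition connected {T : UniformSpace} (D : T -> Prop) : Prop :=
  forall U V : T -> Prop, open U -> open V ->
    (forall x, D x -> U x \/ V x) ->
    (exists x, D x /\ U x) -> (exists x, D x /\ V x) ->
    exists x, D x /\ U x /\ V x.

Definition dp (f : R -> R -> R) (p q : R) : R := Derive (fun x => f x q) p.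
Definition dq (f : R -> R -> R) (p q : R) : R := Derive (fun y => f p y) q.

(* C^n on an open set [D], through continuity of iterated partial derivatives. *)
Fixpoint Cn_on (n : nat) (D : R * R -> Prop) (f : R -> R -> R) : Prop :=
  match n with
  | O => forall x : R * R, D x -> continuous (fun z : R * R => f (fst z) (snd z)) x
  | S m =>
      (forall p q, D (p, q) ->
         ex_derive (fun x => f x q) p /\ ex_derive (fun y => f p y) q)
      /\ Cn_on m D (dp f) /\ Cn_on m D (dq f)
  end.

Definition smooth_on (D : R * R -> Prop) (f : R -> R -> R) : Prop :=
  forall n, Cn_on n D f.

Definition smooth1_on (I : R -> Prop) (f : R -> R) : Prop :=
  forall n x, I x -> ex_derive_n f n x.

Inductive coord : Set := xt | xvarphi | xp | xq.

Definition coord_eq_dec (i j : coord) : {i = j} + {i <> j}.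
Proof. decide equality. Defined.

Definition kron (i j : coord) : R := if coord_eq_dec i j then 1 else 0.

Definition sum4 (f : coord -> R) : R := f xt + f xvarphi + f xp + f xq.

Definition point := coord -> R.
Definition scalar_field := point -> R.
Definition field1 := point -> coord -> R.
Definition field2 := point -> coord -> coord -> R.

Definition upd (X : point) (i : coord) (s : R) : point :=
  fun j => if coord_eq_dec i j then s else X j.

Definition pd (i : coord) (f : scalar_field) : scalar_field :=
  fun X => Derive (fun s => f (upd X i s)) (X i).

Definition lift (f : R -> R -> R) : scalar_field := fun X => f (X xp) (X xq).

Definition lift_region (D : R * R -> Prop) : point -> Prop :=
  fun X => D (X xp, X xq).

Definition is_inverse_metric (M : point -> Prop) (g ginv : field2) : Prop :=
  forall X, M X -> forall m n,
    sum4 (fun l => g X m l * ginv X l n) = kron m n /\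
    sum4 (fun l => ginv X m l * g X l n) = kron m n.

(* [christoffel g ginv X l m n] has its first index [l] up. *)
Definition christoffel (g ginv : field2) (X : point) (l m n : coord) : R :=
  / 2 * sum4 (fun s => ginv X l s *
    (pd m (fun Y => g Y s n) X + pd n (fun Y => g Y s m) X
     - pd s (fun Y => g Y m n) X)).

(* Sign convention: the Ricci tensor of a round sphere is positive. *)
Definition ricci (g ginv : field2) (X : point) (m n : coord) : R :=
  let Gam := christoffel g ginv in
  sum4 (fun l => pd l (fun Y => Gam Y l m n) X)
  - sum4 (fun l => pd n (fun Y => Gam Y l m l) X)
  + sum4 (fun l => sum4 (fun s =>
      Gam X l l s * Gam X s m n - Gam X l n s * Gam X s m l)).

Definition box (g ginv : field2) (phi : scalar_field) (X : point) : R :=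
  sum4 (fun m => sum4 (fun n => ginv X m n *
    (pd m (pd n phi) X
     - sum4 (fun l => christoffel g ginv X l m n * pd l phi X)))).

(* nabla_m H^{mn} for a contravariant tensor H. *)
Definition div2 (g ginv H : field2) (X : point) (n : coord) : R :=
  sum4 (fun m => pd m (fun Y => H Y m n) X
    + sum4 (fun l => christoffel g ginv X m m l * H X l n
                     + christoffel g ginv X n m l * H X m l)).

Definition faraday (A : field1) : field2 :=
  fun X m n => pd m (fun Y => A Y n) X - pd n (fun Y => A Y m) X.

Definition raise2 (ginv F : field2) : field2 := fun X m n =>
  sum4 (fun a => sum4 (fun b => ginv X m a * ginv X n b * F X a b)).

Definition contract2 (F G : field2) (X : point) : R :=
  sum4 (fun a => sum4 (fun b => F X a b * G X a b)).

Definition faraday_sq (ginv F : field2) (X : point) (m n : coord) : R :=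
  sum4 (fun l => sum4 (fun s => ginv X l s * F X m l * F X n s)).

Definition kappa (alpha0 : R) {T : Type} (phi : T -> R) (x : T) : R :=
  exp (- alpha0 * phi x).

(* The field equations on the region [M].  The existence of the inverse matrix
   is the requirement that [g] is a metric on [M]. *)
Definition emd_solution (eps0 alpha0 : R) (M : point -> Prop)
    (g : field2) (A : field1) (phi : scalar_field) : Prop :=
  exists ginv : field2, is_inverse_metric M g ginv /\
  let F := faraday A in
  let Fup := raise2 ginv F in
  let k := kappa alpha0 phi in
  forall X, M X ->
    (forall m n, ricci g ginv X m n =
       2 * eps0 * pd m phi X * pd n phi X
       + 2 * k X ^ 2 * (faraday_sq ginv F X m n - / 4 * g X m n * contract2 F Fup X))
    /\ (forall n, div2 g ginv (fun Y a b => k Y ^ 2 * Fup Y a b) X n = 0)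
    /\ box g ginv phi X = - (alpha0 / (2 * eps0)) * k X ^ 2 * contract2 F Fup X.

Definition Omega (a p q : R) : R := 1 - a * p * q.
Definition Sigma (p q : R) : R := p ^ 2 + q ^ 2.
Definition calR (P Q : R -> R) (p q : R) : R := Q q - P p.

Definition d_t (m : coord) : R := kron xt m.
Definition d_varphi (m : coord) : R := kron xvarphi m.
Definition d_p (m : coord) : R := kron xp m.
Definition d_q (m : coord) : R := kron xq m.

(* At p = q = 0, where Sigma vanishes, this matrix is singular (its q-row is
   zero), so that [emd_solution] excludes that point from the region. *)
Definition carter_metric (Om : R -> R -> R) (P Q : R -> R) : field2 :=
  fun X m n =>
  let p := X xp in let q := X xq in
  let th0 i := d_t i - p ^ 2 * d_varphi i in
  let th3 i := d_t i + q ^ 2 * d_varphi i in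
  / Om p q ^ 2 *
    (- (Q q / Sigma p q) * (th0 m * th0 n)
     + Sigma p q / Q q * (d_q m * d_q n)
     + Sigma p q / P p * (d_p m * d_p n)
     + P p / Sigma p q * (th3 m * th3 n)).

Definition carter_potential (At Aphi : R -> R -> R) : field1 :=
  fun X m => lift At X * d_t m + lift Aphi X * d_varphi m.

(* A real 1-form u dp + v dq at a point is the pair (u, v). *)
Definition d (f : R -> R -> R) (p q : R) : R * R := (dp f p q, dq f p q).

Definition star (P Q : R -> R) (p q : R) (w : R * R) : R * R :=
  (- sqrt (Q q / P p) * snd w, sqrt (P p / Q q) * fst w).

Definition pot_f (Om : R -> R -> R) (P Q : R -> R) (p q : R) : R :=
  calR P Q p q / (Om p q ^ 2 * Sigma p q).

Definition pot_omega (P Q : R -> R) (p q : R) : R :=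
  (Q q * p ^ 2 + P p * q ^ 2) / calR P Q p q.

Definition pot_rho (Om : R -> R -> R) (P Q : R -> R) (p q : R) : R :=
  sqrt (P p * Q q) / Om p q ^ 2.

Definition kappa2 (alpha0 : R) (phi : R -> R -> R) (p q : R) : R :=
  kappa alpha0 (fun z => phi (fst z) (snd z)) (p, q).

Definition d_psi (At : R -> R -> R) (p q : R) : R * R :=
  d (fun x y => 2 * At x y) p q.

(* Only the 1-form d chi, not the potential chi, enters below. *)
Definition d_chi (alpha0 : R) (Om : R -> R -> R) (P Q : R -> R)
    (At Aphi phi : R -> R -> R) (p q : R) : R * R :=
  scal (kappa2 alpha0 phi p q ^ 2)
    (star P Q p q
      (scal (2 * pot_f Om P Q p q / pot_rho Om P Q p q)
        (plus (scal (pot_omega P Q p q) (d At p q)) (d Aphi p q)))).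

Definition B_form (alpha0 : R) (Om : R -> R -> R) (P Q : R -> R)
    (At Aphi phi : R -> R -> R) (p q : R) : C * C :=
  let k := kappa2 alpha0 phi p q in
  let psi' := d_psi At p q in
  let chi' := d_chi alpha0 Om P Q At Aphi phi p q in
  let b (x y : R) : C :=
    (- (1 / (2 * RtoC (sqrt (pot_f Om P Q p q))))
       * (RtoC k * RtoC x - Ci / RtoC k * RtoC y))%C in
  (b (fst psi') (fst chi'), b (snd psi') (snd chi')).

Definition B_minus (alpha0 : R) (Om : R -> R -> R) (P Q : R -> R)
    (At Aphi phi : R -> R -> R) (p q : R) : C :=
  let B := B_form alpha0 Om P Q At Aphi phi p q in
  (fst B - Ci * snd B)%C.

Definition C_form (alpha0 : R) (phi : R -> R -> R) (p q : R) : R * R :=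
  scal alpha0 (d phi p q).

Inductive leg : Set := leg0 | leg1 | leg2 | leg3.

Definition leg_eq_dec (a b : leg) : {a = b} + {a <> b}.
Proof. decide equality. Defined.

Definition carter_coframe (Om : R -> R -> R) (P Q : R -> R)
    (X : point) (a : leg) (m : coord) : R :=
  let p := X xp in let q := X xq in
  match a with
  | leg0 => / Om p q * sqrt (Q q / Sigma p q) * (d_t m - p ^ 2 * d_varphi m)
  | leg1 => / Om p q * sqrt (Sigma p q / Q q) * d_q m
  | leg2 => / Om p q * sqrt (Sigma p q / P p) * d_p m
  | leg3 => / Om p q * sqrt (P p / Sigma p q) * (d_t m + q ^ 2 * d_varphi m)
  end.

Definition is_dual_frame (theta e : leg -> coord -> R) : Prop :=
  forall a b, sum4 (fun m => theta a m * e b m) = if leg_eq_dec a b then 1 else 0.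

Definition csum4 (f : coord -> C) : C := (f xt + f xvarphi + f xp + f xq)%C.

Definition null_k (e : leg -> coord -> R) (m : coord) : C :=
  ((RtoC (e leg0 m) + RtoC (e leg1 m)) / RtoC (sqrt 2))%C.
Definition null_l (e : leg -> coord -> R) (m : coord) : C :=
  ((RtoC (e leg0 m) - RtoC (e leg1 m)) / RtoC (sqrt 2))%C.
Definition null_m (e : leg -> coord -> R) (m : coord) : C :=
  ((RtoC (e leg3 m) + Ci * RtoC (e leg2 m)) / RtoC (sqrt 2))%C.

(* F(u, v) = F_{mn} u^m v^n, bilinear (no conjugation). *)
Definition eval2 (F : coord -> coord -> R) (u v : coord -> C) : C :=
  csum4 (fun m => csum4 (fun n => (RtoC (F m n) * u m * v n)%C)).

Definition carter_aligned (Om : R -> R -> R) (P Q : R -> R) (F : field2)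
    (X : point) : Prop :=
  exists e, is_dual_frame (carter_coframe Om P Q X) e /\
    eval2 (F X) (null_k e) (null_m e) = RtoC 0 /\
    eval2 (F X) (fun m => Cconj (null_m e m)) (null_l e) = RtoC 0.

(* Main.v *)
Require Import Defs.
From Stdlib Require Import Reals Lra Classical.
From Coquelicot Require Import Coquelicot.
Import Defs.

Open Scope R_scope.

(** The proof is the null energy condition.  For arbitrary P(p) and Q(q), and
    Omega = 1 - a p q, the Ricci tensor of the conformal Carter metric satisfies
    R_00 + R_11 = 0 and R_22 = R_33 in the Carter frame.  On the other side the
    field equations give
      R_00 + R_11 = 2 phi_1^2 + 2 kappa^2 (F_02^2 + F_13^2),
    a sum of squares because epsilon_0 = +1 (F_03 = F_12 = 0 as all fields
    depend on (p, q) only).  Hence phi_1 = F_02 = F_13 = 0, and then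
    R_22 - R_33 = 2 phi_2^2 gives phi_2 = 0.  The equations F_02 = F_13 = 0 are
    the alignment of F, and equivalent to B_- = 0. *)

(** * A differential ring of formal expressions in p and q *)

(* Polynomials in p, q, the derivatives of P and Q, and the inverses of Omega,
   Sigma, P, Q.  With the inverses as generators this ring is closed under the
   formal derivatives below without any side condition, so that the Christoffel
   symbols and the Ricci tensor of the Carter metric can be computed in it. *)
Inductive expr : Type :=
  | Ezero | Eone | Ehalf | Ea | Ep | Eq
  | EP (n : nat) | EQ (n : nat)
  | EOmega | EinvOmega | EinvSigma | EinvP | EinvQ
  | Eadd (e f : expr) | Eopp (e : expr) | Emul (e f : expr).

Fixpoint ev (a : R) (P Q : R -> R) (e : expr) (p q : R) : R :=
  match e with
  | Ezero => 0
  | Eone => 1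
  | Ehalf => / 2
  | Ea => a
  | Ep => p
  | Eq => q
  | EP n => Derive_n P n p
  | EQ n => Derive_n Q n q
  | EOmega => Omega a p q
  | EinvOmega => / Omega a p q
  | EinvSigma => / Sigma p q
  | EinvP => / P p
  | EinvQ => / Q q
  | Eadd e f => ev a P Q e p q + ev a P Q f p q
  | Eopp e => - ev a P Q e p q
  | Emul e f => ev a P Q e p q * ev a P Q f p q
  end.

(* Pruning the zeros keeps the formal Ricci tensor small enough for [field]. *)
Definition eadd (e f : expr) : expr :=
  match e, f with Ezero, _ => f | _, Ezero => e | _, _ => Eadd e f end.

Definition eopp (e : expr) : expr :=
  match e with Ezero => Ezero | _ => Eopp e end.

Definition emul (e f : expr) : expr :=
  match e, f with
  | Ezero, _ | _, Ezero => Ezero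
  | Eone, _ => f
  | _, Eone => e
  | _, _ => Emul e f
  end.

Definition esub (e f : expr) : expr := eadd e (eopp f).

Definition esum4 (f : coord -> expr) : expr :=
  eadd (eadd (eadd (f xt) (f xvarphi)) (f xp)) (f xq).

Lemma ev_eadd a P Q e f p q :
  ev a P Q (eadd e f) p q = ev a P Q e p q + ev a P Q f p q.
Proof. destruct e, f; simpl; ring. Qed.

Lemma ev_eopp a P Q e p q : ev a P Q (eopp e) p q = - ev a P Q e p q.
Proof. destruct e; simpl; ring. Qed.

Lemma ev_emul a P Q e f p q :
  ev a P Q (emul e f) p q = ev a P Q e p q * ev a P Q f p q.
Proof. destruct e, f; simpl; ring. Qed.

Lemma ev_esub a P Q e f p q :
  ev a P Q (esub e f) p q = ev a P Q e p q - ev a P Q f p q.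
Proof. unfold esub; rewrite ev_eadd, ev_eopp; ring. Qed.

Lemma ev_esum4 a P Q f p q :
  ev a P Q (esum4 f) p q = sum4 (fun i => ev a P Q (f i) p q).
Proof. unfold esum4, sum4; rewrite !ev_eadd; reflexivity. Qed.

(** The inverse generators obey (1/u)' = -u'/u^2, which stays in the ring. The default case covers
    the constants and the generators in q alone. *)
Fixpoint eDp (e : expr) : expr :=
  match e with
  | Ep => Eone
  | EP n => EP (S n)
  | EOmega => eopp (emul Ea Eq)
  | EinvOmega => emul (emul Ea Eq) (emul EinvOmega EinvOmega)
  | EinvSigma => eopp (emul (eadd Ep Ep) (emul EinvSigma EinvSigma))
  | EinvP => eopp (emul (EP 1) (emul EinvP EinvP))
  | Eadd e f => eadd (eDp e) (eDp f)
  | Eopp e => eopp (eDp e)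
  | Emul e f => eadd (emul (eDp e) f) (emul e (eDp f))
  | _ => Ezero
  end.

Fixpoint eDq (e : expr) : expr :=
  match e with
  | Eq => Eone
  | EQ n => EQ (S n)
  | EOmega => eopp (emul Ea Ep)
  | EinvOmega => emul (emul Ea Ep) (emul EinvOmega EinvOmega)
  | EinvSigma => eopp (emul (eadd Eq Eq) (emul EinvSigma EinvSigma))
  | EinvQ => eopp (emul (EQ 1) (emul EinvQ EinvQ))
  | Eadd e f => eadd (eDq e) (eDq f)
  | Eopp e => eopp (eDq e)
  | Emul e f => eadd (emul (eDq e) f) (emul e (eDq f))
  | _ => Ezero
  end.

Definition epd (i : coord) (e : expr) : expr :=
  match i with xt | xvarphi => Ezero | xp => eDp e | xq => eDq e end.

(** * Carter regions, and agreement of formal with analytic derivatives *)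

Record carter_region (a : R) (P Q : R -> R) (D : R * R -> Prop) : Prop :=
  { region_open : open D;
    region_P_smooth : forall n p q, D (p, q) -> ex_derive_n P n p;
    region_Q_smooth : forall n p q, D (p, q) -> ex_derive_n Q n q;
    region_Omega : forall p q, D (p, q) -> 0 < Omega a p q;
    region_Sigma : forall p q, D (p, q) -> 0 < Sigma p q;
    region_P : forall p q, D (p, q) -> 0 < P p;
    region_Q : forall p q, D (p, q) -> 0 < Q q }.

Lemma ev_is_derive_p a P Q D e p q :
  carter_region a P Q D -> D (p, q) ->
  is_derive (fun x => ev a P Q e x q) p (ev a P Q (eDp e) p q).
Proof.
intros reg Dpq.
pose proof (Rgt_not_eq _ _ (region_Omega _ _ _ _ reg p q Dpq)) as HO.
pose proof (Rgt_not_eq _ _ (region_Sigma _ _ _ _ reg p q Dpq)) as HS.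
pose proof (Rgt_not_eq _ _ (region_P _ _ _ _ reg p q Dpq)) as HP.
pose proof (region_P_smooth _ _ _ _ reg) as sP.
induction e; cbn [ev eDp]; try exact (is_derive_const _ _).
- exact (is_derive_id _).
(* [ex_derive_n P (S n)] unfolds to differentiability of [Derive_n P n]. *)
- apply Derive_correct. exact (sP (S n) p q Dpq).
- unfold Omega; rewrite ev_eopp, ev_emul; cbn; auto_derive; [exact I | ring].
- unfold Omega in *; rewrite !ev_emul; cbn; unfold Omega.
  auto_derive; [exact HO | field; exact HO].
- unfold Sigma in *; rewrite ev_eopp, !ev_emul, ev_eadd; cbn -[pow]; unfold Sigma.
  auto_derive; [exact HS | field; exact HS].
- rewrite ev_eopp, !ev_emul; cbn.
  evar_last; [apply is_derive_inv; [apply Derive_correct; exact (sP 1%nat p q Dpq) | exact HP] |].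
  change (Derive (fun x => P x) p) with (Derive P p).
  field; exact HP.
- rewrite ev_eadd; exact (is_derive_plus _ _ _ _ _ IHe1 IHe2).
- rewrite ev_eopp; exact (is_derive_opp _ _ _ IHe).
- rewrite ev_eadd, !ev_emul.
  exact (is_derive_mult _ _ _ _ _ IHe1 IHe2 Rmult_comm).
Qed.

Lemma ev_is_derive_q a P Q D e p q :
  carter_region a P Q D -> D (p, q) ->
  is_derive (fun y => ev a P Q e p y) q (ev a P Q (eDq e) p q).
Proof.
intros reg Dpq.
pose proof (Rgt_not_eq _ _ (region_Omega _ _ _ _ reg p q Dpq)) as HO.
pose proof (Rgt_not_eq _ _ (region_Sigma _ _ _ _ reg p q Dpq)) as HS.
pose proof (Rgt_not_eq _ _ (region_Q _ _ _ _ reg p q Dpq)) as HQ.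
pose proof (region_Q_smooth _ _ _ _ reg) as sQ.
induction e; cbn [ev eDq]; try exact (is_derive_const _ _).
- exact (is_derive_id _).
- apply Derive_correct. exact (sQ (S n) p q Dpq).
- unfold Omega; rewrite ev_eopp, ev_emul; cbn; auto_derive; [exact I | ring].
- unfold Omega in *; rewrite !ev_emul; cbn; unfold Omega.
  auto_derive; [exact HO | field; exact HO].
- unfold Sigma in *; rewrite ev_eopp, !ev_emul, ev_eadd; cbn -[pow]; unfold Sigma.
  auto_derive; [exact HS | field; exact HS].
- rewrite ev_eopp, !ev_emul; cbn.
  evar_last; [apply is_derive_inv; [apply Derive_correct; exact (sQ 1%nat p q Dpq) | exact HQ] |].
  change (Derive (fun x => Q x) q) with (Derive Q q).
  field; exact HQ.
- rewrite ev_eadd; exact (is_derive_plus _ _ _ _ _ IHe1 IHe2).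
- rewrite ev_eopp; exact (is_derive_opp _ _ _ IHe).
- rewrite ev_eadd, !ev_emul.
  exact (is_derive_mult _ _ _ _ _ IHe1 IHe2 Rmult_comm).
Qed.

Lemma open_slice_p (D : R * R -> Prop) p q :
  open D -> D (p, q) -> locally p (fun x => D (x, q)).
Proof.
intros oD Dpq; destruct (oD _ Dpq) as [eps He].
exists eps; intros x Hx; apply He; split; [exact Hx | apply ball_center].
Qed.

Lemma open_slice_q (D : R * R -> Prop) p q :
  open D -> D (p, q) -> locally q (fun y => D (p, y)).
Proof.
intros oD Dpq; destruct (oD _ Dpq) as [eps He].
exists eps; intros y Hy; apply He; split; [apply ball_center | exact Hy].
Qed.

(** As the region is open, agreement on it is agreement near each point and survives
    differentiation. Moving along t or varphi leaves (p, q) fixed. *)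
Lemma pd_ev a P Q D i (f : scalar_field) e X :
  carter_region a P Q D ->
  (forall Y, lift_region D Y -> f Y = ev a P Q e (Y xp) (Y xq)) ->
  lift_region D X ->
  pd i f X = ev a P Q (epd i e) (X xp) (X xq).
Proof.
intros reg Hf DX.
pose proof (region_open _ _ _ _ reg) as oD.
unfold pd; destruct i; cbn [epd ev].
- rewrite (Derive_ext _ (fun _ => ev a P Q e (X xp) (X xq))); [apply Derive_const |].
  intros s; apply (Hf (upd X xt s)); exact DX.
- rewrite (Derive_ext _ (fun _ => ev a P Q e (X xp) (X xq))); [apply Derive_const |].
  intros s; apply (Hf (upd X xvarphi s)); exact DX.
- apply is_derive_unique.
  apply (is_derive_ext_loc (fun s => ev a P Q e s (X xq))).
  + apply (filter_imp (fun x => D (x, X xq))); [| exact (open_slice_p D _ _ oD DX)].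
    intros s Ds; symmetry; exact (Hf (upd X xp s) Ds).
  + exact (ev_is_derive_p a P Q D e _ _ reg DX).
- apply is_derive_unique.
  apply (is_derive_ext_loc (fun s => ev a P Q e (X xp) s)).
  + apply (filter_imp (fun y => D (X xp, y))); [| exact (open_slice_q D _ _ oD DX)].
    intros s Ds; symmetry; exact (Hf (upd X xq s) Ds).
  + exact (ev_is_derive_q a P Q D e _ _ reg DX).
Qed.

(** * The Carter metric, its inverse and its curvature as formal expressions *)

Definition emetric (m n : coord) : expr :=
  let p2 := emul Ep Ep in
  let q2 := emul Eq Eq in
  let W := emul EinvOmega EinvOmega in
  let WS := emul W EinvSigma in
  match m, n with
  | xt, xt => emul WS (esub (EP 0) (EQ 0))
  | xt, xvarphi | xvarphi, xt =>
      emul WS (eadd (emul (EQ 0) p2) (emul (EP 0) q2))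
  | xvarphi, xvarphi =>
      emul WS (esub (emul (EP 0) (emul q2 q2)) (emul (EQ 0) (emul p2 p2)))
  | xp, xp => emul W (emul EinvP (eadd p2 q2))
  | xq, xq => emul W (emul EinvQ (eadd p2 q2))
  | _, _ => Ezero
  end.

(** The inverse metric is Omega^2/Sigma times (p^2 d_t + d_varphi)^2/P - (q^2 d_t - d_varphi)^2/Q +
    P d_p^2 + Q d_q^2, with d_i the coordinate vector fields. *)
Definition einverse (m n : coord) : expr :=
  let p2 := emul Ep Ep in
  let q2 := emul Eq Eq in
  let OS := emul (emul EOmega EOmega) EinvSigma in
  match m, n with
  | xt, xt => emul OS (esub (emul EinvP (emul p2 p2)) (emul EinvQ (emul q2 q2)))
  | xt, xvarphi | xvarphi, xt => emul OS (eadd (emul EinvP p2) (emul EinvQ q2))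
  | xvarphi, xvarphi => emul OS (esub EinvP EinvQ)
  | xp, xp => emul OS (EP 0)
  | xq, xq => emul OS (EQ 0)
  | _, _ => Ezero
  end.

Lemma carter_metric_ev a P Q D X m n :
  carter_region a P Q D -> lift_region D X ->
  carter_metric (Omega a) P Q X m n = ev a P Q (emetric m n) (X xp) (X xq).
Proof.
intros reg DX.
pose proof (Rgt_not_eq _ _ (region_Omega _ _ _ _ reg _ _ DX)) as HO.
pose proof (Rgt_not_eq _ _ (region_Sigma _ _ _ _ reg _ _ DX)) as HS.
pose proof (Rgt_not_eq _ _ (region_P _ _ _ _ reg _ _ DX)) as HP.
pose proof (Rgt_not_eq _ _ (region_Q _ _ _ _ reg _ _ DX)) as HQ.
unfold carter_metric, d_t, d_varphi, d_p, d_q, kron, Sigma in *.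
destruct m, n; cbn -[pow]; unfold Sigma; field; auto.
Qed.

Lemma emetric_einverse a P Q D p q m n :
  carter_region a P Q D -> D (p, q) ->
  sum4 (fun l => ev a P Q (emetric m l) p q * ev a P Q (einverse l n) p q) = kron m n.
Proof.
intros reg Dpq.
pose proof (Rgt_not_eq _ _ (region_Omega _ _ _ _ reg _ _ Dpq)) as HO.
pose proof (Rgt_not_eq _ _ (region_Sigma _ _ _ _ reg _ _ Dpq)) as HS.
pose proof (Rgt_not_eq _ _ (region_P _ _ _ _ reg _ _ Dpq)) as HP.
pose proof (Rgt_not_eq _ _ (region_Q _ _ _ _ reg _ _ Dpq)) as HQ.
unfold sum4, kron, Sigma in *.
destruct m, n; cbn -[pow]; unfold Sigma; field; auto.
Qed.

(** h = h (g k) = (h g) k = k. *)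
Lemma left_inverse_unique (g h k : coord -> coord -> R) :
  (forall m n, sum4 (fun l => h m l * g l n) = kron m n) ->
  (forall m n, sum4 (fun l => g m l * k l n) = kron m n) ->
  forall m n, h m n = k m n.
Proof.
intros Hl Hr m n.
transitivity (sum4 (fun l => h m l * sum4 (fun s => g l s * k s n))).
- unfold sum4 at 1; rewrite !Hr; unfold kron; destruct n; cbn; ring.
- transitivity (sum4 (fun s => sum4 (fun l => h m l * g l s) * k s n)).
  + unfold sum4; ring.
  + unfold sum4 at 1; rewrite !Hl; unfold kron; destruct m; cbn; ring.
Qed.

(** The field equations only assert that some inverse metric exists; uniqueness turns it into an
    explicit expression, which can then be differentiated. *)
Lemma inverse_metric_ev a P Q D ginv X m n :
  carter_region a P Q D ->
  is_inverse_metric (lift_region D) (carter_metric (Omega a) P Q) ginv ->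
  lift_region D X ->
  ginv X m n = ev a P Q (einverse m n) (X xp) (X xq).
Proof.
intros reg Hinv DX.
apply (left_inverse_unique (carter_metric (Omega a) P Q X) (ginv X)
  (fun m n => ev a P Q (einverse m n) (X xp) (X xq))).
- intros i j; apply (Hinv X DX i j).
- intros i j; rewrite <- (emetric_einverse a P Q D (X xp) (X xq) i j reg DX).
  unfold sum4; rewrite !(carter_metric_ev a P Q D X) by assumption; reflexivity.
Qed.

Definition echristoffel (l m n : coord) : expr :=
  emul Ehalf (esum4 (fun s => emul (einverse l s)
    (esub (eadd (epd m (emetric s n)) (epd n (emetric s m))) (epd s (emetric m n))))).

Definition ericci (m n : coord) : expr :=
  eadd (esub (esum4 (fun l => epd l (echristoffel l m n)))
             (esum4 (fun l => epd n (echristoffel l m l))))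
       (esum4 (fun l => esum4 (fun s =>
          esub (emul (echristoffel l l s) (echristoffel s m n))
               (emul (echristoffel l n s) (echristoffel s m l))))).

Lemma sum4_ext (f g : coord -> R) : (forall i, f i = g i) -> sum4 f = sum4 g.
Proof. intros H; unfold sum4; rewrite !H; reflexivity. Qed.

Lemma christoffel_ev a P Q D ginv X l m n :
  carter_region a P Q D ->
  is_inverse_metric (lift_region D) (carter_metric (Omega a) P Q) ginv ->
  lift_region D X ->
  christoffel (carter_metric (Omega a) P Q) ginv X l m n
  = ev a P Q (echristoffel l m n) (X xp) (X xq).
Proof.
intros reg Hinv DX.
unfold christoffel, echristoffel; rewrite ev_emul, ev_esum4; cbn [ev].
apply f_equal, sum4_ext; intros s.
rewrite ev_emul, ev_esub, ev_eadd, (inverse_metric_ev a P Q D) by assumption.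
assert (Hg : forall i j k, pd k (fun Y => carter_metric (Omega a) P Q Y i j) X
    = ev a P Q (epd k (emetric i j)) (X xp) (X xq)).
{ intros i j k; apply (pd_ev a P Q D); [exact reg | | exact DX].
  intros Y DY; exact (carter_metric_ev a P Q D Y i j reg DY). }
rewrite !Hg; reflexivity.
Qed.

(** [christoffel_ev] holds on the whole region, not just at one point, so [pd_ev] applies to the
    Christoffel symbols in turn. *)
Lemma ricci_ev a P Q D ginv X m n :
  carter_region a P Q D ->
  is_inverse_metric (lift_region D) (carter_metric (Omega a) P Q) ginv ->
  lift_region D X ->
  ricci (carter_metric (Omega a) P Q) ginv X m n
  = ev a P Q (ericci m n) (X xp) (X xq).
Proof.
intros reg Hinv DX.
assert (HG : forall l i j, christoffel (carter_metric (Omega a) P Q) ginv X l i j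
    = ev a P Q (echristoffel l i j) (X xp) (X xq)).
{ intros l i j; exact (christoffel_ev a P Q D ginv X l i j reg Hinv DX). }
assert (HdG : forall l i j k,
    pd k (fun Y => christoffel (carter_metric (Omega a) P Q) ginv Y l i j) X
    = ev a P Q (epd k (echristoffel l i j)) (X xp) (X xq)).
{ intros l i j k; apply (pd_ev a P Q D); [exact reg | | exact DX].
  intros Y DY; exact (christoffel_ev a P Q D ginv Y l i j reg Hinv DY). }
unfold ricci, ericci; cbv zeta.
rewrite ev_eadd, ev_esub, !ev_esum4.
f_equal; [f_equal |]; apply sum4_ext; intros l; [apply HdG | apply HdG |].
rewrite ev_esum4; apply sum4_ext; intros s.
rewrite ev_esub, !ev_emul, !HG; reflexivity.
Qed.

(** * Two combinations of Ricci components that vanish identically *)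

(* q^2 d_t - d_varphi and Q d_q are the same multiple of e_0 and e_1, so this
   is R_00 + R_11 = 0. *)
Lemma ricci_e0_e1 a P Q D p q :
  carter_region a P Q D -> D (p, q) ->
  let Ric m n := ev a P Q (ericci m n) p q in
  q ^ 4 * Ric xt xt - 2 * q ^ 2 * Ric xt xvarphi + Ric xvarphi xvarphi
  + Q q ^ 2 * Ric xq xq = 0.
Proof.
intros reg Dpq Ric.
pose proof (Rgt_not_eq _ _ (region_Omega _ _ _ _ reg _ _ Dpq)) as HO.
pose proof (Rgt_not_eq _ _ (region_Sigma _ _ _ _ reg _ _ Dpq)) as HS.
pose proof (Rgt_not_eq _ _ (region_P _ _ _ _ reg _ _ Dpq)) as HP.
pose proof (Rgt_not_eq _ _ (region_Q _ _ _ _ reg _ _ Dpq)) as HQ.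
unfold Sigma in HS; unfold Ric.
(* What remains is an identity of rational functions in a, p, q, Omega and the derivatives of P and
   Q, all of these derivatives being independent atoms. *)
cbv -[Rplus Rmult Ropp Rinv R0 R1 IZR Rminus pow Derive_n Omega Sigma].
change (Derive_n P 0 p) with (P p); change (Derive_n Q 0 q) with (Q q).
unfold Sigma; field; auto.
Qed.

(* p^2 d_t + d_varphi and P d_p are the same multiple of e_3 and e_2, so this
   is R_33 - R_22 = 0. *)
Lemma ricci_e2_e3 a P Q D p q :
  carter_region a P Q D -> D (p, q) ->
  let Ric m n := ev a P Q (ericci m n) p q in
  p ^ 4 * Ric xt xt + 2 * p ^ 2 * Ric xt xvarphi + Ric xvarphi xvarphi
  - P p ^ 2 * Ric xp xp = 0.
Proof.
intros reg Dpq Ric.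
pose proof (Rgt_not_eq _ _ (region_Omega _ _ _ _ reg _ _ Dpq)) as HO.
pose proof (Rgt_not_eq _ _ (region_Sigma _ _ _ _ reg _ _ Dpq)) as HS.
pose proof (Rgt_not_eq _ _ (region_P _ _ _ _ reg _ _ Dpq)) as HP.
pose proof (Rgt_not_eq _ _ (region_Q _ _ _ _ reg _ _ Dpq)) as HQ.
unfold Sigma in HS; unfold Ric.
cbv -[Rplus Rmult Ropp Rinv R0 R1 IZR Rminus pow Derive_n Omega Sigma].
change (Derive_n P 0 p) with (P p); change (Derive_n Q 0 q) with (Q q).
unfold Sigma; field; auto.
Qed.

(** * The Einstein equations at a point of the region *)

Lemma pd_lift f i X :
  pd i (lift f) X =
  match i with
  | xt | xvarphi => 0
  | xp => dp f (X xp) (X xq)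
  | xq => dq f (X xp) (X xq)
  end.
Proof. destruct i; try reflexivity; exact (Derive_const (lift f X) _). Qed.

Definition carter_faraday (At Aphi : R -> R -> R) (p q : R) (m n : coord) : R :=
  match m, n with
  | xp, xt => dp At p q
  | xt, xp => - dp At p q
  | xp, xvarphi => dp Aphi p q
  | xvarphi, xp => - dp Aphi p q
  | xq, xt => dq At p q
  | xt, xq => - dq At p q
  | xq, xvarphi => dq Aphi p q
  | xvarphi, xq => - dq Aphi p q
  | _, _ => 0
  end.

Lemma faraday_carter_potential At Aphi X m n :
  faraday (carter_potential At Aphi) X m n = carter_faraday At Aphi (X xp) (X xq) m n.
Proof.
pose (A n := match n with xt => At | xvarphi => Aphi | _ => fun _ _ => 0 end).
assert (HA : forall i j, pd i (fun Y => carter_potential At Aphi Y j) X = pd i (lift (A j)) X).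
{ intros i j; unfold pd; apply Derive_ext; intros s.
  unfold carter_potential, d_t, d_varphi, kron, lift; destruct j; cbn; ring. }
unfold faraday; rewrite !HA, !pd_lift.
assert (H0 : forall c x, Derive (fun _ => c) x = 0) by exact Derive_const.
destruct m, n; cbn; unfold dp, dq; rewrite ?H0; ring.
Qed.

Lemma weighted_squares_eq0 a b c x y z :
  0 < a -> 0 < b -> 0 < c -> a * x ^ 2 + b * y ^ 2 + c * z ^ 2 = 0 ->
  x = 0 /\ y = 0 /\ z = 0.
Proof.
intros Ha Hb Hc H.
pose proof (Rmult_le_pos a (x ^ 2) (Rlt_le _ _ Ha) (pow2_ge_0 x)).
pose proof (Rmult_le_pos b (y ^ 2) (Rlt_le _ _ Hb) (pow2_ge_0 y)).
pose proof (Rmult_le_pos c (z ^ 2) (Rlt_le _ _ Hc) (pow2_ge_0 z)).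
assert (Z : forall k t, 0 < k -> k * t ^ 2 = 0 -> t = 0).
{ intros k t Hk Hkt; apply Rmult_integral in Hkt as [Hkt | Hkt]; [lra |].
  destruct (Req_dec t 0) as [| Ht]; [assumption | now apply (pow_nonzero t 2) in Ht]. }
split; [apply (Z a) | split; [apply (Z b) | apply (Z c)]]; lra.
Qed.

(** The Einstein equations turn [ricci_e0_e1] into a vanishing sum of squares of phi_q, q^2 A_t,p -
    A_varphi,p and p^2 A_t,q + A_varphi,q, the last two being multiples of F_02 and F_13.
    [ricci_e2_e3] then yields phi_p = 0. *)
Lemma carter_fields alpha0 a P Q D At Aphi phi p q :
  carter_region a P Q D ->
  emd_solution 1 alpha0 (lift_region D)
    (carter_metric (Omega a) P Q) (carter_potential At Aphi) (lift phi) ->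
  D (p, q) ->
  dp phi p q = 0 /\ dq phi p q = 0 /\
  dp Aphi p q = q ^ 2 * dp At p q /\ dq Aphi p q = - p ^ 2 * dq At p q.
Proof.
intros reg [ginv [Hinv Hsol]] Dpq.
(* The fields depend on (p, q) only, so the point with t = varphi = 0 represents its whole fibre. *)
pose (X i := match i with xp => p | xq => q | _ => 0 end).
assert (DX : lift_region D X) by exact Dpq.
destruct (Hsol X DX) as [Hricci _]; clear Hsol.
pose proof (region_Omega _ _ _ _ reg _ _ Dpq) as HO.
pose proof (region_Sigma _ _ _ _ reg _ _ Dpq) as HS.
pose proof (region_P _ _ _ _ reg _ _ Dpq) as HP.
pose proof (region_Q _ _ _ _ reg _ _ Dpq) as HQ.
pose proof (ricci_e0_e1 a P Q D p q reg Dpq) as R01.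
pose proof (ricci_e2_e3 a P Q D p q reg Dpq) as R23.
cbv beta zeta in Hricci, R01, R23.
set (k := kappa alpha0 (lift phi) X) in Hricci.
assert (Hk : 0 < k) by apply exp_pos.
set (N := contract2 _ _ X) in Hricci.
(* The equation in the (m, n) components, with the trace N left opaque: it
   drops out since g_00 + g_11 = 0 and g_22 = g_33. *)
assert (HT : forall m n, ev a P Q (ericci m n) p q =
  2 * pd m (lift phi) X * pd n (lift phi) X
  + 2 * k ^ 2 * (sum4 (fun l => sum4 (fun s => ev a P Q (einverse l s) p q
      * carter_faraday At Aphi p q m l * carter_faraday At Aphi p q n s))
    - / 4 * ev a P Q (emetric m n) p q * N)).
{ intros m n.
  pose proof (Hricci m n) as H.
  rewrite (ricci_ev a P Q D) in H by assumption.
  change (X xp) with p in H; change (X xq) with q in H.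
  rewrite H, (carter_metric_ev a P Q D X m n reg DX), Rmult_1_r.
  replace (faraday_sq ginv (faraday (carter_potential At Aphi)) X m n) with
    (sum4 (fun l => sum4 (fun s => ev a P Q (einverse l s) p q
      * carter_faraday At Aphi p q m l * carter_faraday At Aphi p q n s))).
  { reflexivity. }
  unfold faraday_sq; apply sum4_ext; intros l; apply sum4_ext; intros s.
  rewrite (inverse_metric_ev a P Q D), !faraday_carter_potential by assumption.
  reflexivity. }
rewrite !HT, !pd_lift in R01, R23; clear HT Hricci.
change (X xp) with p in *; change (X xq) with q in *.
cbv -[Rplus Rmult Ropp Rinv R0 R1 IZR Rminus pow Derive_n Omega Sigma dp dq Rlt k N] in R01, R23.
change (Derive_n P 0 p) with (P p) in *; change (Derive_n Q 0 q) with (Q q) in *.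
set (phip := dp phi p q) in *; set (phiq := dq phi p q) in *.
set (x := dp At p q) in *; set (y := dq At p q) in *.
set (z := dp Aphi p q) in *; set (w := dq Aphi p q) in *.
clearbody N k phip phiq x y z w.
set (c := k ^ 2 * Omega a p q ^ 2 * / Sigma p q).
assert (Hc : 0 < c).
{ unfold c; apply Rmult_lt_0_compat; [apply Rmult_lt_0_compat |];
    [now apply pow_lt | now apply pow_lt | now apply Rinv_0_lt_compat]. }
(* Half of [R01]. The N terms cancel, and [eps0 = 1] gives the scalar term the same sign as the
   Maxwell terms. *)
assert (S01 : Q q ^ 2 * phiq ^ 2 + c * P p * (q ^ 2 * x - z) ^ 2
    + c * (Q q ^ 2 / P p) * (p ^ 2 * y + w) ^ 2 = 0).
{ apply (Rmult_eq_reg_l 2); [| lra]; rewrite Rmult_0_r, <- R01; unfold c, Sigma in *.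
  field; lra. }
apply weighted_squares_eq0 in S01 as (Hphiq & Hz & Hw);
  [ | now apply pow_lt | now apply Rmult_lt_0_compat
  | apply Rmult_lt_0_compat; [assumption |];
    apply Rdiv_lt_0_compat; [now apply pow_lt | assumption] ].
(* Once F_02 = F_13 = 0, the Maxwell field enters R_22 and R_33 equally through F_23^2, so [R23]
   reduces to -2 P^2 phi_p^2 = 0. *)
assert (S23 : P p ^ 2 * phip ^ 2 = 0).
{ replace z with (q ^ 2 * x) in * by lra; replace w with (- (p ^ 2 * y)) in * by lra.
  apply (Rmult_eq_reg_l (-2)); [| lra]; rewrite Rmult_0_r, <- R23; unfold c, Sigma in *.
  field; lra. }
apply Rmult_integral in S23 as [S23 | S23];
  [now apply pow_nonzero in S23; [| lra] |].
repeat split; try lra.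
destruct (Req_dec phip 0) as [| Hne]; [assumption | now apply (pow_nonzero _ 2) in Hne].
Qed.

(** * From vanishing partial derivatives to a constant function *)

Lemma constant_of_zero_derive (f : R -> R) x0 (eps : posreal) :
  (forall x, ball x0 eps x -> ex_derive f x /\ Derive f x = 0) ->
  forall x, ball x0 eps x -> f x = f x0.
Proof.
intros Hf x Hx.
assert (Hd : forall t, Rabs (t - x0) < eps -> is_derive f t zero).
{ intros t Ht; destruct (Hf t Ht) as [Hex H0].
  change zero with 0; rewrite <- H0; now apply Derive_correct. }
change (Rabs (x - x0) < eps) in Hx; apply Rabs_def2 in Hx.
destruct (Rtotal_order x x0) as [Hlt | [-> | Hlt]]; [| reflexivity |].
- apply eq_is_derive; [| exact Hlt].
  intros t Ht; apply Hd, Rabs_def1; lra.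
- symmetry; apply eq_is_derive; [| exact Hlt].
  intros t Ht; apply Hd, Rabs_def1; lra.
Qed.

(** Inside a box in D, a path along q and then along p shows f constant. Hence a level set of f and
    its complement in D are both open, and connectedness forbids both to be nonempty. *)
Lemma constant_on_connected (D : R * R -> Prop) (f : R -> R -> R) :
  open D -> connected D ->
  (forall p q, D (p, q) -> ex_derive (fun x => f x q) p /\ ex_derive (fun y => f p y) q) ->
  (forall p q, D (p, q) -> dp f p q = 0 /\ dq f p q = 0) ->
  exists c, forall p q, D (p, q) -> f p q = c.
Proof.
intros oD cD exf df.
assert (Hloc : forall p q, D (p, q) ->
    locally (p, q) (fun z => D z /\ f (fst z) (snd z) = f p q)).
{ intros p q Dpq; destruct (oD _ Dpq) as [eps He].
  exists eps; intros [x y] [Hx Hy]; cbn in Hx, Hy |- *.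
  split; [now apply He; split |].
  transitivity (f p y).
  - apply (constant_of_zero_derive (fun x => f x y) p eps); [| exact Hx].
    intros t Ht; assert (Dt : D (t, y)) by now apply He; split.
    split; [apply (exf _ _ Dt) | apply (df _ _ Dt)].
  - apply (constant_of_zero_derive (fun y => f p y) q eps); [| exact Hy].
    intros t Ht; assert (Dt : D (p, t)).
    { apply He; split; [apply ball_center | exact Ht]. }
    split; [apply (exf _ _ Dt) | apply (df _ _ Dt)]. }
destruct (classic (exists z, D z)) as [[[p0 q0] D0] | nD].
2: { exists 0; intros p q Dpq; destruct nD; now exists (p, q). }
exists (f p0 q0); intros p q Dpq; apply NNPP; intros Hne.
destruct (cD (fun z => D z /\ f (fst z) (snd z) = f p0 q0)
             (fun z => D z /\ f (fst z) (snd z) <> f p0 q0))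
  as [z (_ & [_ H1] & [_ H2])].
- intros [x y] [Dxy Hxy]; cbn in Hxy; rewrite <- Hxy; exact (Hloc x y Dxy).
- intros [x y] [Dxy Hxy]; cbn in Hxy.
  apply (filter_imp _ _) with (2 := Hloc x y Dxy).
  intros z [Dz Hz]; split; [exact Dz | now rewrite Hz].
- intros z Dz; destruct (classic (f (fst z) (snd z) = f p0 q0)); [left | right]; now split.
- now exists (p0, q0).
- now exists (p, q).
- contradiction.
Qed.

(** * Positivity of Sigma, vanishing of B_- and alignment *)

(** If Sigma = 0, the only possibly nonzero entry Sigma/(Q Omega^2) of the q-row of the metric
    vanishes too, so the (q, q) entry of the product with the inverse would be 0 instead of 1. *)
Lemma emd_carter_Sigma_pos eps0 alpha0 Om P Q D A phi p q :
  emd_solution eps0 alpha0 (lift_region D) (carter_metric Om P Q) A phi ->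
  D (p, q) -> 0 < Sigma p q.
Proof.
intros [ginv [Hinv _]] Dpq.
pose (X i := match i with xp => p | xq => q | _ => 0 end).
destruct (Hinv X Dpq xq xq) as [H _].
assert (HS : 0 <= Sigma p q).
{ unfold Sigma; pose proof (pow2_ge_0 p); pose proof (pow2_ge_0 q); lra. }
destruct HS as [HS | HS]; [exact HS | exfalso].
unfold sum4, carter_metric, d_t, d_varphi, d_p, d_q, kron in H.
cbn -[pow Sigma] in H; rewrite <- HS in H; unfold Rdiv in H.
rewrite !Rmult_0_r, !Rmult_0_l in H; ring_simplify in H; lra.
Qed.

(** Reduces both radicals of the Hodge operator to the radical sqrt(P Q) of rho. *)
Lemma sqrt_quotient_product (x y : R) : 0 < x -> 0 < y -> sqrt (x / y) = sqrt (x * y) / y.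
Proof.
intros Hx Hy; apply sqrt_lem_1.
- left; now apply Rdiv_lt_0_compat.
- apply Rmult_le_pos; [apply sqrt_pos | left; now apply Rinv_0_lt_compat].
- replace (sqrt (x * y) / y * (sqrt (x * y) / y))
    with (sqrt (x * y) * sqrt (x * y) / (y * y)) by (field; lra).
  rewrite sqrt_sqrt by (left; now apply Rmult_lt_0_compat); field; lra.
Qed.

(** The relations on dA give d chi = kappa^2 (-psi_q, psi_p). Hence B_q = -i B_p, and B_p - i B_q =
    0. *)
Lemma B_minus_eq0 alpha0 a P Q At Aphi phi p q :
  0 < Omega a p q -> 0 < Sigma p q -> 0 < P p -> 0 < Q q -> 0 < calR P Q p q ->
  dp Aphi p q = q ^ 2 * dp At p q -> dq Aphi p q = - p ^ 2 * dq At p q ->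
  B_minus alpha0 (Omega a) P Q At Aphi phi p q = RtoC 0.
Proof.
intros HO HS HP HQ HR Hz Hw.
unfold B_minus, B_form; cbv zeta.
set (k := kappa2 alpha0 phi p q).
assert (Hk : k <> 0) by (apply Rgt_not_eq, exp_pos).
set (pre := (- (1 / (2 * RtoC (sqrt (pot_f (Omega a) P Q p q)))))%C).
assert (Hpsi : d_psi At p q = (2 * dp At p q, 2 * dq At p q)).
{ unfold d_psi, d, dp, dq; rewrite !Derive_scal; reflexivity. }
assert (Hs : 0 < sqrt (P p * Q q)) by now apply sqrt_lt_R0, Rmult_lt_0_compat.
(* Here omega + q^2 = Q Sigma/R and omega - p^2 = P Sigma/R, so all factors except 2 kappa^2 cancel
   against f/rho and the Hodge operator. *)
assert (Hchi : d_chi alpha0 (Omega a) P Q At Aphi phi p q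
    = (- (2 * k ^ 2 * dq At p q), 2 * k ^ 2 * dp At p q)).
{ unfold d_chi, star; fold k; unfold d; cbn -[pow sqrt dp dq].
  rewrite Hz, Hw, (sqrt_quotient_product (Q q) (P p)) by assumption.
  rewrite (sqrt_quotient_product (P p) (Q q)) by assumption.
  rewrite (Rmult_comm (Q q) (P p)).
  cbv [scal plus mult]; cbn -[pow sqrt dp dq].
  cbv [prod_scal scal mult]; cbn -[pow sqrt dp dq].
  unfold pot_f, pot_omega, pot_rho, calR, Sigma in *.
  apply injective_projections; cbn [fst snd]; field; repeat split; lra. }
rewrite Hpsi, Hchi; cbn [fst snd].
unfold Cdiv; rewrite <- RtoC_inv by exact Hk.
(* The bracket vanishes by itself, whatever the prefactor. *)
unfold pre; generalize (- (1 / (2 * RtoC (sqrt (pot_f (Omega a) P Q p q)))))%C; intros [u v].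
unfold Cminus, Cplus, Cmult, Copp, RtoC, Ci; cbn -[pow dp dq].
apply injective_projections; cbn -[pow dp dq]; field; exact Hk.
Qed.

(** F(k, m) and F(conj m, l) combine only F_02, F_03, F_12 and F_13. F_03 and F_12 vanish by the
    form of the potential, F_02 and F_13 by the two relations. *)
Lemma carter_aligned_intro a P Q At Aphi X :
  let p := X xp in let q := X xq in
  0 < Omega a p q -> 0 < Sigma p q -> 0 < P p -> 0 < Q q ->
  dp Aphi p q = q ^ 2 * dp At p q -> dq Aphi p q = - p ^ 2 * dq At p q ->
  carter_aligned (Omega a) P Q (faraday (carter_potential At Aphi)) X.
Proof.
intros p q HO HS HP HQ Hz Hw.
(* The dual frame: e_0 is along q^2 d_t - d_varphi and e_3 along p^2 d_t + d_varphi. Each is killed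
   by the other's coframe form, and its own form gives the factor Sigma that is divided out. *)
pose (e b m := match b, m with
  | leg0, xt => Omega a p q * / sqrt (Q q / Sigma p q) * / Sigma p q * q ^ 2
  | leg0, xvarphi => - (Omega a p q * / sqrt (Q q / Sigma p q) * / Sigma p q)
  | leg1, xq => Omega a p q * / sqrt (Sigma p q / Q q)
  | leg2, xp => Omega a p q * / sqrt (Sigma p q / P p)
  | leg3, xt => Omega a p q * / sqrt (P p / Sigma p q) * / Sigma p q * p ^ 2
  | leg3, xvarphi => Omega a p q * / sqrt (P p / Sigma p q) * / Sigma p q
  | _, _ => 0
  end).
exists e; split; [| split].
- assert (Hsq : forall x y, 0 < x -> 0 < y -> sqrt (x / y) <> 0).
  { intros x y Hx Hy; apply Rgt_not_eq, sqrt_lt_R0; now apply Rdiv_lt_0_compat. }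
  intros b c; unfold e, sum4, carter_coframe, d_t, d_varphi, d_p, d_q, kron.
  fold p q.
  assert (H1 := Hsq _ _ HQ HS); assert (H2 := Hsq _ _ HP HS).
  assert (H3 := Hsq _ _ HS HQ); assert (H4 := Hsq _ _ HS HP).
  revert H1 H2 H3 H4.
  generalize (sqrt (Q q / Sigma p q)) as s0, (sqrt (P p / Sigma p q)) as s3.
  generalize (sqrt (Sigma p q / Q q)) as s1, (sqrt (Sigma p q / P p)) as s2.
  intros; unfold Sigma in *; destruct b, c; cbn -[pow]; field; repeat split; lra.
- unfold eval2, csum4, null_k, null_m, Cdiv; rewrite !faraday_carter_potential; fold p q.
  cbn -[pow RtoC Cplus Cmult Cinv sqrt dp dq]; rewrite Hz, Hw.
  generalize (/ RtoC (sqrt 2))%C; intros [u v].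
  unfold Cplus, Cmult, RtoC, Ci; cbn -[pow sqrt dp dq].
  apply injective_projections; cbn -[pow sqrt dp dq]; ring.
- unfold eval2, csum4, null_l, null_m, Cdiv; rewrite !faraday_carter_potential; fold p q.
  cbn -[pow RtoC Cplus Cmult Cinv Cminus Cconj sqrt dp dq]; rewrite Hz, Hw.
  generalize (/ RtoC (sqrt 2))%C; intros [u v].
  unfold Cconj, Cminus, Copp, Cplus, Cmult, RtoC, Ci; cbn -[pow sqrt dp dq].
  apply injective_projections; cbn -[pow sqrt dp dq]; ring.
Qed.

(** * Conclusion on the whole region *)

Theorem mainTheorem2
  (alpha0 a : R) (halpha0 : alpha0 <> 0)
  (D : R * R -> Prop) (hopen : open D) (hconn : connected D)
  (P Q : R -> R)
  (hP : smooth1_on (fun p => exists q, D (p, q)) P)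
  (hQ : smooth1_on (fun q => exists p, D (p, q)) Q)
  (hpos : forall p q, D (p, q) ->
     0 < Omega a p q /\ 0 < P p /\ 0 < Q q /\ 0 < calR P Q p q)
  (At Aphi phi : R -> R -> R)
  (hAt : smooth_on D At) (hAphi : smooth_on D Aphi) (hphi : smooth_on D phi)
  (hsol : emd_solution 1 alpha0 (lift_region D)
            (carter_metric (Omega a) P Q) (carter_potential At Aphi) (lift phi)) :
  (forall p q, D (p, q) ->
     C_form alpha0 phi p q = (0, 0) /\
     B_minus alpha0 (Omega a) P Q At Aphi phi p q = RtoC 0)
  /\ (exists c, forall p q, D (p, q) -> phi p q = c)
  /\ (forall X, lift_region D X ->
        carter_aligned (Omega a) P Q (faraday (carter_potential At Aphi)) X).
Proof.
assert (hSigma : forall p q, D (p, q) -> 0 < Sigma p q).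
{ intros p q; exact (emd_carter_Sigma_pos _ _ _ _ _ _ _ _ p q hsol). }
assert (reg : carter_region a P Q D).
{ split; [exact hopen | | | | exact hSigma | |].
  - intros n p q Dpq; apply hP; now exists q.
  - intros n p q Dpq; apply hQ; now exists p.
  - intros p q Dpq; apply (hpos p q Dpq).
  - intros p q Dpq; apply (hpos p q Dpq).
  - intros p q Dpq; apply (hpos p q Dpq). }
assert (fields := fun p q => carter_fields alpha0 a P Q D At Aphi phi p q reg hsol).
split; [| split].
- intros p q Dpq.
  destruct (fields p q Dpq) as (Hp & Hq & Hz & Hw).
  destruct (hpos p q Dpq) as (HO & HP & HQ & HR).
  split; [| apply B_minus_eq0; auto].
  unfold C_form, d; rewrite Hp, Hq.
  exact (scal_zero_r (V := prod_NormedModule _ R_NormedModule R_NormedModule) alpha0).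
- apply constant_on_connected; [assumption | assumption | |].
  (* [Derive] is total, so its vanishing does not give differentiability; that comes from smoothness
     at order 1. *)
  + intros p q Dpq; exact (proj1 (hphi 1%nat) p q Dpq).
  + intros p q Dpq; destruct (fields p q Dpq) as (Hp & Hq & _); now split.
- intros X DX.
  destruct (fields _ _ DX) as (_ & _ & Hz & Hw).
  destruct (hpos _ _ DX) as (HO & HP & HQ & _).
  apply carter_aligned_intro; auto.
Qed.
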